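(* Let $M=\bigoplus_{i=1}^r I_ie_i\subsetneq F$ be a squarefree stable submodule, and let $k\ge 0$ and $\ell$ be integers. The following conditions are equivalent: (1) $\beta_{k,k+\ell}(M)$ is an extremal Betti number of $M$; (2) $k+\ell=\max\{\mathrm{m}(u)+f_i : ue_i\in G(M)_\ell,\ i=1,\dots,r\}$ (in particular $G(M)_\ell\neq\emptyset$), and $\mathrm{m}(u)+f_i<k+j$ for all $j>\ell$ and all $ue_i\in G(M)_j$.
   Context: $K$ is a field, $S=K[x_1,\dots,x_n]$ with $\deg x_i=1$, and $F=\bigoplus_{i=1}^r Se_i$ is a finitely generated graded free $S$-module with basis $e_1,\dots,e_r$ in degrees $f_1\le f_2\le\dots\le f_r$. For a monomial $u\in S$, $\deg(ue_i)=\deg u+f_i$. For a monomial $u\ne 1$ of $S$, $\mathrm{supp}(u)=\{i : x_i\mid u\}$ and $\mathrm{m}(u)=\max \mathrm{supp}(u)$; $\mathrm{m}(1)=0$. For $1\le d\le n$, $[x_1,\dots,x_n]^d$ is the ideal of $S$ generated by all squarefree monomials of degree $d$; by convention $[x_1,\dots,x_n]^0=S$ and $[x_1,\dots,x_n]^d=0$ for $d>n$. A squarefree monomial ideal is an ideal generated by squarefree monomials. A submodule $M$ of $F$ is a squarefree stable submodule if: (a) $M=\bigoplus_{i=1}^r I_ie_i$ with each $I_i\subsetneq S$ a squarefree monomial ideal; (b) for every squarefree monomial $u\in S$ and every $i$ with $ue_i\in M$, one has $x_j\frac{u}{x_{\mathrm{m}(u)}}e_i\in M$ for all $j<\mathrm{m}(u)$,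 $j\notin\mathrm{supp}(u)$; (c) $[x_1,\dots,x_n]^{f_j-f_i}I_j\subseteq I_i$ for all $j>i$. $G(I)$ is the minimal set of monomial generators of a monomial ideal $I$. $G(M)=\{ue_i : u\in G(I_i),\ i=1,\dots,r\}$, and $G(M)_\ell=\{ue_i : u\in G(I_i),\ \deg u=\ell-f_i,\ i=1,\dots,r\}$. $\beta_{i,j}(M)=\dim_K\mathrm{Tor}_i^S(K,M)_j$ are the graded Betti numbers. A Betti number $\beta_{k,k+\ell}(M)$ is extremal if $\beta_{k,k+\ell}(M)\neq 0$ and $\beta_{i,i+j}(M)=0$ for all $i\ge k$, $j\ge\ell$, $(i,j)\ne(k,\ell)$. *)

(* Defs.v *)
From mathcomp Require Import all_boot all_order all_algebra.
From mathcomp Require Import mpoly.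
From Stdlib Require Import ClassicalEpsilon.

Set Implicit Arguments.
Unset Strict Implicit.
Unset Printing Implicit Defensive.

Import Order.TTheory GRing.Theory Num.Theory.
Local Open Scope ring_scope.

(* The polynomial ring S is {mpoly K[n]}.  Its variables are indexed by 'I_n,
   so the variable of index q : 'I_n is x_(q+1).  The free module F is
   'rV[{mpoly K[n]}]_r, its basis vector of index i sitting in degree f i. *)

Section Monomials.
Variable n : nat.

Definition sqfree (u : 'X_{1..n}) : Prop := forall q : 'I_n, (u q <= 1)%N.

Definition supp (u : 'X_{1..n}) : {set 'I_n} := [set q | u q != 0%N].

(* m(u) is a 1-based index, and m(1) = 0 *)
Definition mmax (u : 'X_{1..n}) : nat := \max_(q in supp u) q.+1.

End Monomials.

Section Ideals.
Variables (K : fieldType) (n : nat).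
Local Notation S := {mpoly K[n]}.

Definition ideal_gen (A : S -> Prop) (p : S) : Prop :=
  exists s : seq (S * S),
    (forall ca, ca \in s -> A ca.2) /\ p = \sum_(ca <- s) ca.1 * ca.2.

Definition mono_ideal (B : 'X_{1..n} -> Prop) : S -> Prop :=
  ideal_gen (fun p => exists u, B u /\ p = 'X_[u]).

Definition ideal_mul (I J : S -> Prop) : S -> Prop :=
  ideal_gen (fun p => exists a b, [/\ I a, J b & p = a * b]).

(* [x_1, ..., x_n]^d; it is S for d = 0 and 0 for d > n *)
Definition sqfree_power (d : nat) : S -> Prop :=
  mono_ideal (fun u => sqfree u /\ mdeg u = d).

Definition sqfree_monomial_ideal (I : S -> Prop) : Prop :=
  exists B : 'X_{1..n} -> Prop,
    (forall u, B u -> sqfree u) /\ (forall p, I p <-> mono_ideal B p).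

Definition minimal_mono_gens (I : S -> Prop) (B : 'X_{1..n} -> Prop) : Prop :=
  (forall p, I p <-> mono_ideal B p) /\
  (forall B' : 'X_{1..n} -> Prop,
     (forall u, B' u -> B u) -> (forall p, I p <-> mono_ideal B' p) ->
     forall u, B u -> B' u).

(* u belongs to G(I) *)
Definition in_G (I : S -> Prop) (u : 'X_{1..n}) : Prop :=
  exists B, minimal_mono_gens I B /\ B u.

End Ideals.

Section Modules.
Variables (K : fieldType) (n r : nat) (f : 'I_r -> int).
Local Notation S := {mpoly K[n]}.
Local Notation F := 'rV[S]_r.

(* the monomial u e_i of F *)
Definition mono_elt (u : 'X_{1..n}) (i : 'I_r) : F :=
  'X_[u] *: delta_mx 0 i.

Definition sqfree_stable (I : 'I_r -> S -> Prop) (M : F -> Prop) : Prop :=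
  [/\ (forall v, M v <-> forall i, I i (v 0 i)) /\
      (forall i, sqfree_monomial_ideal (I i) /\ exists p, ~ I i p),
      forall (u : 'X_{1..n}) (i : 'I_r), sqfree u -> M (mono_elt u i) ->
        forall q j : 'I_n, q.+1 = mmax u -> (j < q)%N -> j \notin supp u ->
          M (mono_elt (U_(j) + (u - U_(q)))%MM i)
    & forall i j : 'I_r, (i < j)%N ->
        forall p, ideal_mul (@sqfree_power K n `|f j - f i|%N) (I j) p -> I i p].

(* u e_i belongs to G(M)_l *)
Definition in_GM (I : 'I_r -> S -> Prop) (l : int) (u : 'X_{1..n}) (i : 'I_r) :
    Prop :=
  in_G (I i) u /\ (mdeg u)%:Z = l - f i.

(* Graded free resolutions, given by matrices acting on row vectors: the i-th
   module is 'rV[S]_(rk i) with basis vector of index c in degree gdeg c. *)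
Record free_complex := FreeComplex {
  rk : nat -> nat;
  gdeg : forall i : nat, 'I_(rk i) -> int;
  diff : forall i : nat, 'M[S]_(rk i.+1, rk i);
  aug : 'M[S]_(rk 0, r)
}.

Definition homogeneous (p : S) (z : int) : Prop :=
  forall m, m \in msupp p -> (mdeg m)%:Z = z.

Definition graded_free_resolution (M : F -> Prop) (P : free_complex) : Prop :=
  [/\ (forall c i, homogeneous (aug P c i) (gdeg c - f i)) /\
      (forall i c c', homogeneous (diff P i c c') (gdeg c - gdeg c')),
      forall v : F, M v <-> exists w, v = w *m aug P,
      forall w : 'rV_(rk P 0), w *m aug P = 0 <-> exists w', w = w' *m diff P 0
    & forall (i : nat) (w : 'rV_(rk P i.+1)),
        w *m diff P i = 0 <-> exists w', w = w' *m diff P i.+1].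

Section Tor.
Variable P : free_complex.

(* The complex K (x)_S P.  The map S -> K sends every variable to 0, and the
   row space of tens_deg i j is the degree-j part of K (x)_S P_i. *)
Definition tens_diff (i : nat) : 'M[K]_(rk P i.+1, rk P i) :=
  map_mx (meval (fun=> 0)) (diff P i).

Definition tens_deg (i : nat) (j : int) : 'M[K]_(rk P i) :=
  diag_mx (\row_c (gdeg c == j)%:R).

Definition cycles (i : nat) (j : int) : 'M[K]_(rk P i) :=
  match i with
  | 0%N => tens_deg 0 j
  | i'.+1 => (tens_deg i'.+1 j :&: kermx (tens_diff i'))%MS
  end.

Definition boundaries (i : nat) (j : int) : 'M[K]_(rk P i.+1, rk P i) :=
  tens_deg i.+1 j *m tens_diff i.

(* dim_K H_i(K (x)_S P)_j *)
Definition tor_dim (i : nat) (j : int) : nat :=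
  (\rank (cycles i j) - \rank (boundaries i j))%N.

End Tor.

(* dim_K Tor_i^S(K, M)_j, computed from any graded free resolution of M by
   finitely generated modules *)
Definition betti (M : F -> Prop) (i : nat) (j : int) : nat :=
  epsilon (inhabits 0%N)
    (fun b => exists P, graded_free_resolution M P /\ b = tor_dim P i j).

Definition extremal_betti (M : F -> Prop) (k : nat) (l : int) : Prop :=
  betti M k (k%:Z + l) <> 0%N /\
  forall (i : nat) (j : int), (k <= i)%N -> l <= j -> (i, j) <> (k, l) ->
    betti M i (i%:Z + j) = 0%N.

End Modules.

Definition is_max (A : int -> Prop) (x : int) : Prop :=
  A x /\ forall y, A y -> y <= x.

(* Main.v *)
Require Import Defs.
From HB Require Import structures.
From mathcomp Require Import all_boot all_order all_algebra.
From mathcomp Require Import mpoly ring zify.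
From Stdlib Require Import Classical ClassicalEpsilon.

Set Implicit Arguments.
Unset Strict Implicit.
Unset Printing Implicit Defensive.

Import Order.TTheory GRing.Theory Num.Theory.
Local Open Scope ring_scope.

(* The theorem is a formal consequence of the fact that beta_{i,i+j}(M) <> 0 iff
   some u e_a in G(M)_j satisfies i + j <= m(u) + f_a.  To prove this fact:
   - Tor is independent of the resolution: shifting dimension along a resolution
     P, using only the exactness of the Koszul complex of a free module,
     identifies nonzero classes of H_i(K (x) P) with nonzero classes in the
     Koszul homology of M, of the same homological and internal degree.
   - If no such u e_a exists, a Koszul cycle of M is a boundary: in each
     multidegree, wedge with a variable of exponent at least 2 if there is one,
     with the last variable otherwise; squarefreeness, respectively stability,
     keeps the coefficients in M.
   - If u e_a is such an element and s is a set of i variables below m(u) not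
     dividing u, the boundary of (u/x_m(u)) e_(s + m(u)) has coefficients in M by
     stability, and its coefficient u of e_s is a minimal generator, so that it is
     not a boundary of a form with coefficients in M.
   A finitely generated graded free resolution exists because the leading
   monomials of a graded submodule are finitely generated (Dickson). *)

(** * Homogeneous polynomials *)

Section Polynomials.
Variables (K : fieldType) (n : nat).
Local Notation S := {mpoly K[n]}.
Implicit Types (p q : S) (m : 'X_{1..n}).

(** Needed because the Koszul homotopy is prescribed coefficient by coefficient. *)
Lemma mpoly_of_coeffs (E : 'X_{1..n} -> K) d :
  (forall m, E m != 0 -> (mdeg m < d)%N) -> exists p : S, forall m, p@_m = E m.
Proof.
move=> hE; exists (\sum_(m : 'X_{1..n < d}) (E m *: 'X_[m])) => m.
case: (ltnP (mdeg m) d) => [|hm]; first exact: mcoeff_mpoly.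
have /eqP -> : E m == 0.
  by apply: contraLR hm => /hE; rewrite ltnNge.
rewrite raddf_sum big1 //= => -[i /= hi] _.
rewrite mcoeffZ mcoeffX; case: eqP => [e|_]; last by rewrite mulr0.
by move: hi; rewrite e ltnNge hm.
Qed.

Lemma mcoeff_signM e p m : ((-1) ^+ e * p)@_m = (-1) ^+ e * p@_m.
Proof.
rewrite -signr_odd -[in RHS]signr_odd.
by case: (odd e); rewrite ?expr1 ?expr0 ?mulN1r ?mul1r ?mcoeffN.
Qed.

Lemma mcoeffXM m' p m :
  ('X_[m'] * p)@_m = if (m' <= m)%MM then p@_(m - m')%MM else 0.
Proof.
rewrite mulrC; case: ifPn => [le|nle].
  by rewrite -{1}[m](submK le) addmC mcoeffMX.
apply/eqP; rewrite mcoeff_eq0 (perm_mem (msuppMX _ _)).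
by apply: contra nle => /mapP[m1 _ ->]; apply: lem_addr.
Qed.

Lemma mcoeffXUM s p m :
  ('X_s * p)@_m = if m s != 0%N then p@_(m - U_(s))%MM else 0.
Proof. by rewrite mcoeffXM lep1mP. Qed.

Lemma meval0_coeff p : meval (fun=> 0) p = p@_0%MM.
Proof.
rewrite [X in meval _ X]mpolyE raddf_sum /=.
rewrite (eq_bigr (fun m => p@_m * (m == 0%MM)%:R)); last first.
  move=> m _; rewrite mevalZ mevalX; congr (_ * _).
  case: (eqVneq m 0%MM) => [->|nz]; first by rewrite big1 // => i _; rewrite mnm0E.
  have [i hi] : exists i, m i != 0%N.
    apply/existsP; rewrite -negb_forall; apply: contra nz => /forallP h.
    by apply/eqP/mnmP => i; rewrite mnm0E; apply/eqP.
  by rewrite (bigD1 i) //= expr0n (negbTE hi) mul0r.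
case: (boolP (0%MM \in msupp p)) => h.
  rewrite (bigD1_seq _ h) ?msupp_uniq //= eqxx mulr1 big1 ?addr0 // => m nm.
  by rewrite (negbTE nm) mulr0.
rewrite (memN_msupp_eq0 h) big_seq big1 // => m hm.
by case: eqP hm => [->|]; [rewrite (negbTE h)|rewrite mulr0].
Qed.

Lemma homogeneous0 z : homogeneous (0 : S) z.
Proof. by move=> m; rewrite mcoeff_msupp mcoeff0 eqxx. Qed.

Lemma homogeneousN z p : homogeneous p z -> homogeneous (- p) z.
Proof. by move=> hp m; rewrite mcoeff_msupp mcoeffN oppr_eq0 -mcoeff_msupp; apply: hp. Qed.

Lemma homogeneousD z p q : homogeneous p z -> homogeneous q z -> homogeneous (p + q) z.
Proof. by move=> hp hq m /msuppD_le; rewrite mem_cat => /orP[/hp|/hq]. Qed.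

Lemma homogeneousM z w p q :
  homogeneous p z -> homogeneous q w -> homogeneous (p * q) (z + w).
Proof.
move=> hp hq m /msuppM_le /allpairsP[[m1 m2] /= [/hp h1 /hq h2 ->]].
by rewrite mdegD PoszD h1 h2.
Qed.

Lemma homogeneous_sum z (T : Type) (r : seq T) (P : pred T) (F : T -> S) :
  (forall t, P t -> homogeneous (F t) z) -> homogeneous (\sum_(t <- r | P t) F t) z.
Proof.
move=> h; apply: (big_ind (fun p : S => homogeneous p z)) => //; first exact: homogeneous0.
by move=> p q; exact: homogeneousD.
Qed.

Lemma homogeneousX m : homogeneous ('X_[m] : S) (mdeg m)%:Z.
Proof. by move=> m'; rewrite msuppX inE => /eqP ->. Qed.

Lemma homogeneousC (c : K) : homogeneous (c%:MP : S) 0.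
Proof. by move=> m; rewrite msuppC; case: ifP => //; rewrite inE => _ /eqP ->; rewrite mdeg0. Qed.

Lemma homogeneous_sign e z p : homogeneous p z -> homogeneous ((-1) ^+ e * p) z.
Proof.
move=> hp; rewrite -signr_odd; case: (odd e); rewrite ?mulN1r ?mul1r //.
exact: homogeneousN.
Qed.

Definition hcomp (z : int) p : S :=
  \sum_(m <- msupp p | (mdeg m)%:Z == z) p@_m *: 'X_[m].

Lemma mcoeff_hcomp z p m : (hcomp z p)@_m = if (mdeg m)%:Z == z then p@_m else 0.
Proof.
rewrite raddf_sum /= -big_filter.
case: (boolP (m \in [seq m <- msupp p | (mdeg m)%:Z == z])) => h.
  rewrite (bigD1_seq _ h) ?filter_uniq ?msupp_uniq //= big1.
    move: h; rewrite mem_filter => /andP[-> _].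
    by rewrite mcoeffZ mcoeffX eqxx mulr1 addr0.
  by move=> m' nm; rewrite mcoeffZ mcoeffX (negbTE nm) mulr0.
rewrite big_seq big1 => [|m' hm'].
  move: h; rewrite mem_filter negb_and; case: ifP => //= _.
  by rewrite -mcoeff_eq0 => /eqP ->.
rewrite mcoeffZ mcoeffX; case: eqP h => [<-|]; last by rewrite mulr0.
by rewrite hm'.
Qed.

Lemma homogeneous_hcomp z p : homogeneous (hcomp z p) z.
Proof. by move=> m; rewrite mcoeff_msupp mcoeff_hcomp; case: ifP => [/eqP //|_]; rewrite eqxx. Qed.

Lemma msupp_hcomp z p m : m \in msupp (hcomp z p) -> m \in msupp p.
Proof. by rewrite !mcoeff_msupp mcoeff_hcomp; case: ifP => // _; rewrite eqxx. Qed.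

Lemma hcomp_is_additive z : zmod_morphism (hcomp z).
Proof.
move=> p q; apply/mpolyP => m; rewrite mcoeffB !mcoeff_hcomp mcoeffB.
by case: ifP => //; rewrite subr0.
Qed.
HB.instance Definition _ z := GRing.isZmodMorphism.Build S S (hcomp z) (hcomp_is_additive z).

Lemma hcomp_id z p : homogeneous p z -> hcomp z p = p.
Proof.
move=> hp; apply/mpolyP => m; rewrite mcoeff_hcomp; case: eqP => // nz.
by apply/esym/eqP; rewrite mcoeff_eq0; apply/negP => /hp.
Qed.

(** Split [p] into its component of degree [z - w] and the rest: times [q], the first is homogeneous
    of degree [z], and the rest has no monomial of that degree. *)
Lemma hcompM z w p q : homogeneous q w -> hcomp z (p * q) = hcomp (z - w) p * q.
Proof.
move=> hq; rewrite -[p in LHS](subrK (hcomp (z - w) p)) mulrDl raddfD /=.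
rewrite [X in _ + X]hcomp_id; last first.
  rewrite -[z](subrK w); apply: homogeneousM => //.
  by rewrite subrK; apply: homogeneous_hcomp.
rewrite [X in X + _](_ : _ = 0) ?add0r //; apply/mpolyP => m.
rewrite mcoeff_hcomp mcoeff0; case: eqP => // hm; apply/eqP; rewrite mcoeff_eq0.
apply/negP => /msuppM_le /allpairsP[[m1 m2] /= [h1 /hq h2 em]].
move: h1; rewrite mcoeff_msupp mcoeffB mcoeff_hcomp.
by rewrite -hm em mdegD PoszD h2 addrK eqxx subrr eqxx.
Qed.

End Polynomials.

(** * The Koszul complex of a free module *)

Section Koszul.
Variables (K : fieldType) (n : nat).
Local Notation S := {mpoly K[n]}.
Implicit Types (s t : 'I_n) (sg tau : {set 'I_n}) (m : 'X_{1..n}).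

(** The exponent of the sign that moves e_s to its place in the wedge product of [sg]. *)
Definition kpos s sg : nat := #|[set t in sg | (t < s)%N]|.

(* A p-form with coefficients in 'rV[S]_k is a family w indexed by the subsets of
   'I_n and supported on the subsets of size p: w sg is the coefficient of e_sg. *)
Definition kdiff k (w : {set 'I_n} -> 'rV[S]_k) sg : 'rV[S]_k :=
  \sum_(s | s \notin sg) ((-1) ^+ kpos s sg * 'X_s) *: w (s |: sg).

(** With it, the term x^m e_tau has multidegree [m + mset tau], which [kdiff] preserves. *)
Definition mset tau : 'X_{1..n} := [multinom (i \in tau : nat) | i < n].

Lemma kpos_setU1 s t sg : t \notin sg -> kpos s (t |: sg) = ((t < s) + kpos s sg)%N.
Proof.
move=> ht; rewrite /kpos; case: (boolP (t < s)%N) => h.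
  rewrite (_ : [set _ in _ | _] = t |: [set x in sg | (x < s)%N]).
    by rewrite cardsU1 !inE (negbTE ht).
  apply/setP => x; rewrite !inE andb_orl; case: eqP => [->|] //=.
  by rewrite h.
rewrite add0n; congr #|pred_of_set _|; apply/setP => x.
rewrite !inE; case: eqP => [->|] //=.
by rewrite (negbTE h) andbF.
Qed.

Lemma msetU1 s sg : s \notin sg -> mset (s |: sg) = (U_(s) + mset sg)%MM.
Proof.
move=> hs; apply/mnmP => i; rewrite mnmDE mnm1E !mnmE !inE [i == s]eq_sym.
by case: eqP => [<-|]; rewrite ?(negbTE hs).
Qed.

Lemma mdeg_mset sg : mdeg (mset sg) = #|sg|.
Proof.
rewrite mdegE -sum1_card [RHS]big_mkcond /=.
by apply: eq_bigr => i _; rewrite mnmE; case: (_ \in _).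
Qed.

Lemma kdiffB k (w w' : {set 'I_n} -> 'rV[S]_k) sg :
  kdiff (fun tau => w tau - w' tau) sg = kdiff w sg - kdiff w' sg.
Proof. by rewrite /kdiff -sumrB; apply: eq_bigr => s _; rewrite scalerBr. Qed.

Lemma kdiff_mulmx k k' (w : {set 'I_n} -> 'rV[S]_k) (A : 'M_(k, k')) sg :
  kdiff (fun tau => w tau *m A) sg = kdiff w sg *m A.
Proof. by rewrite /kdiff mulmx_suml; apply: eq_bigr => s _; rewrite scalemxAl. Qed.

Lemma eq_kdiff k (w w' : {set 'I_n} -> 'rV[S]_k) sg :
  (forall tau, tau != set0 -> w tau = w' tau) -> kdiff w sg = kdiff w' sg.
Proof.
move=> h; apply: eq_bigr => s _; rewrite h //.
by apply/set0Pn; exists s; rewrite setU11.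
Qed.

Lemma kdiff_size k (w : {set 'I_n} -> 'rV[S]_k) i :
  (forall tau, #|tau| != i.+1 -> w tau = 0) ->
  forall sg, #|sg| != i -> kdiff w sg = 0.
Proof.
move=> h sg hsg; apply: big1 => s hs; rewrite h ?scaler0 //.
by rewrite cardsU1 hs.
Qed.

Lemma kdiffE k (w : {set 'I_n} -> 'rV[S]_k) sg c m :
  (kdiff w sg 0 c)@_m = \sum_(s | (s \notin sg) && (m s != 0%N))
     (-1) ^+ kpos s sg * (w (s |: sg) 0 c)@_(m - U_(s))%MM.
Proof.
rewrite summxE raddf_sum /= big_mkcondr /=; apply: eq_bigr => s _.
by rewrite mxE -mulrA mcoeff_signM mcoeffXUM; case: ifP; rewrite ?mulr0.
Qed.

(** The terms inserting [s], [t] in the two possible orders cancel: the larger variable counts the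
    smaller one in its sign only when it is inserted second. *)
Lemma kdiff_kdiff k (w : {set 'I_n} -> 'rV[S]_k) sg : kdiff (kdiff w) sg = 0.
Proof.
pose G s t : 'rV[S]_k := ((-1) ^+ kpos s sg * 'X_s) *:
  (((-1) ^+ kpos t (s |: sg) * 'X_t) *: w (t |: (s |: sg))).
have GA s t : s \notin sg -> t \notin sg -> (s < t)%N -> G t s = - G s t.
  move=> hs ht hst; rewrite /G !scalerA setUCA -scaleNr; congr (_ *: _).
  rewrite !kpos_setU1 // hst ltnNge (ltnW hst) /= add0n add1n exprS; ring.
pose P s t := (s \notin sg) && (t \notin sg).
have -> : kdiff (kdiff w) sg =
    \sum_(s | s \notin sg) \sum_(t | (t \notin sg) && (t != s)) G s t.
  apply: eq_bigr => s hs; rewrite scaler_sumr; apply: eq_big => // t.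
  by rewrite !inE negb_or andbC.
have split s : \sum_(t | (t \notin sg) && (t != s)) G s t =
    \sum_(t | (t \notin sg) && (s < t)%N) G s t
    + \sum_(t | (t \notin sg) && (t < s)%N) G s t.
  rewrite (bigID (fun t : 'I_n => (s < t)%N)) /=; congr (_ + _); apply: eq_bigl => t.
    by case: (_ \notin _) => //=; rewrite -val_eqE neq_ltn; case: ltngtP.
  by case: (_ \notin _) => //=; rewrite -val_eqE neq_ltn; case: ltngtP.
under eq_bigr do rewrite split.
rewrite big_split /= [X in _ + X](exchange_big_dep (fun t => t \notin sg)) /=; last first.
  by move=> s t _ /andP[].
rewrite -big_split /= big1 // => s hs.
rewrite [X in _ + X](eq_bigl (fun t : 'I_n => (t \notin sg) && (s < t)%N)); last first.
  by move=> t; rewrite hs.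
rewrite [X in _ + X](eq_bigr (fun t => - G s t)); first by rewrite sumrN subrr.
by move=> t /andP[ht hst]; rewrite GA.
Qed.

(* The homotopy is defined in each multidegree a separately: it wedges with e_s and
   divides by x_s, where q a = Some s.  The support condition on eta serves to keep
   track of degrees and of membership of the coefficients in an ideal. *)
Lemma koszul_contract k (w : {set 'I_n} -> 'rV[S]_k) (q : 'X_{1..n} -> option 'I_n) :
  (forall sg, kdiff w sg = 0) ->
  (forall tau c m, m \in msupp (w tau 0 c) ->
     exists s, q (m + mset tau)%MM = Some s /\ (m + mset tau)%MM s != 0%N) ->
  exists eta : {set 'I_n} -> 'rV[S]_k,
    (forall sg, kdiff eta sg = w sg) /\
    (forall tau c m, m \in msupp (eta tau 0 c) ->
       exists s, [/\ q (m + mset tau)%MM = Some s, s \in tau &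
         (m + U_(s))%MM \in msupp (w (tau :\ s) 0 c)]).
Proof.
move=> hw hq.
(* Wedging with e_s and dividing by x_s: the coefficient at [(tau, m)] is read at
   [(tau :\ s, m + U_(s))], in the same multidegree. *)
pose E tau c m : K := if q (m + mset tau)%MM is Some s then
   if s \in tau then (-1) ^+ kpos s (tau :\ s) * (w (tau :\ s) 0 c)@_(m + U_(s))%MM else 0
   else 0.
have EP tau c m : E tau c m != 0 -> exists s, [/\ q (m + mset tau)%MM = Some s, s \in tau &
         (m + U_(s))%MM \in msupp (w (tau :\ s) 0 c)].
  rewrite /E; case: (q _) => [s|]; last by rewrite eqxx.
  case: ifP => [hs|]; last by rewrite eqxx.
  by rewrite mulf_eq0 negb_or -mcoeff_msupp => /andP[_ h]; exists s.
have exE tau c : exists p : S, forall m, p@_m = E tau c m.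
  apply: (@mpoly_of_coeffs _ _ (E tau c) (\max_s msize (w (tau :\ s) 0%R c))) => m /EP[s [_ _ h]].
  apply: leq_trans (leq_bigmax s); apply: leq_trans (msize_mdeg_lt h).
  by rewrite mdegD ltnS leq_addr.
have [eta hE] : exists eta : {set 'I_n} -> 'rV[S]_k, forall tau c m, (eta tau 0 c)@_m = E tau c m.
  have /fin_all_exists[g hg] : forall tau, exists v : 'rV[S]_k, forall c m, (v 0 c)@_m = E tau c m.
    move=> tau; have [v hv] := fin_all_exists (exE tau).
    by exists (\row_c v c) => c m; rewrite mxE.
  by exists g.
exists eta; split; last by move=> tau c m; rewrite mcoeff_msupp hE; exact: EP.
move=> sg; apply/rowP => c; apply/mpolyP => m.
rewrite kdiffE; under eq_bigr do rewrite hE.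
have key s : s \notin sg -> m s != 0%N -> (m - U_(s) + mset (s |: sg) = m + mset sg)%MM.
  by move=> hs hm; rewrite msetU1 // addmA submK // lep1mP.
case eq: (q (m + mset sg)%MM) => [r|]; last first.
  rewrite big1; last by move=> s /andP[hs hm]; rewrite /E key // eq mulr0.
  apply/esym/eqP; rewrite mcoeff_eq0; apply/negP => /hq[s [h _]].
  by rewrite h in eq.
(* If [r] is in [sg], the cycle condition at [sg :\ r] in the monomial [m + U_(r)] expresses the
   coefficient of [w sg] through the sets [s |: sg :\ r], which are those read by [E]. *)
case: (boolP (r \in sg)) => hr.
  have e2 := hw (sg :\ r).
  have {e2}: (kdiff w (sg :\ r) 0 c)@_(m + U_(r))%MM = 0 by rewrite e2 mxE mcoeff0.
  rewrite kdiffE (bigD1 r) /=; last by rewrite setD11 mnmDE mnm1E eqxx addn1.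
  rewrite setD1K // addmK => /eqP; rewrite addr_eq0 => /eqP h.
  have {h}-> : (w sg 0 c)@_m = - \sum_(s | [&& (s \notin sg :\ r), ((m + U_(r))%MM s != 0%N) & s != r])
     (-1) ^+ kpos r (sg :\ r) * ((-1) ^+ kpos s (sg :\ r) *
      (w (s |: sg :\ r) 0 c)@_(m + U_(r) - U_(s))%MM).
    rewrite -mulr_sumr; apply: (@mulfI _ ((-1) ^+ kpos r (sg :\ r))).
      by rewrite signr_eq0.
    rewrite mulrN mulrA -expr2 sqrr_sign mul1r h; congr (- _).
    by apply: eq_bigl => s; rewrite andbA.
  rewrite -sumrN; apply: eq_big => s.
    rewrite !inE mnmDE mnm1E; case: (eqVneq s r) => [->|_]; first by rewrite hr !andbF.
    by rewrite addn0 andbT.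
  move=> /andP[hs hm]; rewrite /E key // eq !inE hr orbT.
  have nsr : s != r by apply: contraNneq hs => ->.
  have e : (s |: sg) :\ r = s |: (sg :\ r).
    by apply/setP => x; rewrite !inE; case: (eqVneq x s) => [->|] //; rewrite nsr.
  have e3 : (m - U_(s) + U_(r) = m + U_(r) - U_(s))%MM.
    by rewrite addmC addmBA ?lep1mP // addmC.
  rewrite e e3 kpos_setU1 ?inE ?negb_and ?hs ?orbT // mulrA mulrA.
  rewrite -mulNr; congr (_ * _).
  have -> : kpos s sg = ((r < s) + kpos s (sg :\ r))%N.
    by rewrite -{1}(setD1K hr) kpos_setU1 // !inE eqxx.
  rewrite !exprD; move: nsr; rewrite -val_eqE neq_ltn => /orP[] h.
    by rewrite h ltnNge (ltnW h) /= expr0 expr1; ring.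
  by rewrite h ltnNge (ltnW h) /= expr0 expr1; ring.
(* Here x_r does not divide the multidegree, so that [w] has no term there and both sides vanish. *)
case: (eqVneq (m r) 0%N) => hmr.
  rewrite big1; last first.
    move=> s /andP[hs hm]; rewrite /E key // eq !inE (negbTE hr) orbF.
    case: eqVneq => [e|]; last by rewrite mulr0.
    by rewrite -e hmr in hm.
  apply/esym/eqP; rewrite mcoeff_eq0; apply/negP => /hq[s []].
  by rewrite eq => -[<-]; rewrite mnmDE hmr mnmE (negbTE hr).
(* In this multidegree [eta] lives on sets containing [r]; only the insertion of [r] contributes. *)
rewrite (bigD1 r) /= ?hr // big1 ?addr0; last first.
  move=> s /andP[/andP[hs hm] hsr]; rewrite /E key // eq !inE (negbTE hr) orbF.
  by rewrite eq_sym (negbTE hsr) mulr0.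
rewrite /E key // eq setU11 setU1K // mulrA -expr2 sqrr_sign mul1r.
by rewrite submK ?lep1mP.
Qed.

(** Contract with any variable dividing the multidegree. Only multidegree 0 has none, and it occurs
    only as the constant term at the empty set. *)
Lemma koszul_acyclic k (w : {set 'I_n} -> 'rV[S]_k) :
  (forall sg, kdiff w sg = 0) -> (forall c, (w set0 0 c)@_0%MM = 0) ->
  exists eta : {set 'I_n} -> 'rV[S]_k,
    (forall sg, kdiff eta sg = w sg) /\
    (forall tau c m, m \in msupp (eta tau 0 c) ->
       exists s, s \in tau /\ (m + U_(s))%MM \in msupp (w (tau :\ s) 0 c)).
Proof.
move=> hw h0; pose q m := [pick s | m s != 0%N].
have [||eta [h1 h2]] := @koszul_contract k w q; first exact: hw.
  move=> tau c m hm; rewrite /q; case: pickP => [s hs|no]; first by exists s.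
  have em : (m + mset tau)%MM = 0%MM.
    by apply/mnmP => i; rewrite mnm0E; apply/eqP/negPn/negbT/no.
  have et : tau = set0.
    apply/setP => i; rewrite inE; move/mnmP/(_ i): em.
    by rewrite mnmDE mnm0E [mset tau i]mnmE; case: (i \in tau) => //; rewrite addn1.
  move: hm; rewrite et mcoeff_msupp (_ : m = 0%MM) ?h0 ?eqxx //.
  by apply/mnmP => i; move/mnmP/(_ i): em; rewrite mnmDE mnm0E => /eqP; rewrite addn_eq0 => /andP[/eqP].
exists eta; split => // tau c m /h2[s [_ ? ?]]; by exists s.
Qed.

End Koszul.

(** * Tor and Koszul homology *)

Section Homology.
Variables (K : fieldType) (n : nat).
Local Notation S := {mpoly K[n]}.
Local Notation ev0 := (@meval n K (fun=> 0)).

Definition vhom k (g : 'I_k -> int) (z : int) (v : 'rV[S]_k) : Prop :=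
  forall c, homogeneous (v 0 c) (z - g c).

Definition mxhom k k' (g : 'I_k -> int) (g' : 'I_k' -> int) (A : 'M[S]_(k, k')) : Prop :=
  forall c c', homogeneous (A c c') (g c - g' c').

(* Existence of a nonzero class of degree j in the i-th Koszul homology of the
   submodule Z.  For i = 0, the flag e restricts to elements of Z that are in
   (x_1, ..., x_n) times the ambient free module: these are the classes that the
   connecting map from homological degree 1 reaches. *)
Definition kclass (e : bool) (i : nat) k (g : 'I_k -> int) (Z : 'rV[S]_k -> Prop)
    (j : int) : Prop :=
  exists w : {set 'I_n} -> 'rV[S]_k,
    [/\ [/\ forall tau : {set 'I_n}, #|tau| != i -> w tau = 0,
            forall tau, vhom g (j - i%:Z) (w tau) &
            forall tau, Z (w tau)],
        forall sg, kdiff w sg = 0,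
        e -> forall c, (w set0 0 c)@_0%MM = 0 &
        ~ exists eta : {set 'I_n} -> 'rV[S]_k,
            (forall tau, Z (eta tau)) /\ forall sg, kdiff eta sg = w sg].

Lemma eq_kclass e i k (g : 'I_k -> int) (Z Z' : 'rV[S]_k -> Prop) j :
  (forall v, Z v <-> Z' v) -> kclass e i g Z j <-> kclass e i g Z' j.
Proof.
move=> h; split=> -[w [[h1 h2 h3] h4 h5 h6]]; exists w; split=> //; try split => //.
- by move=> tau; apply/h.
- by case=> eta [e1 e2]; apply: h6; exists eta; split => // tau; apply/h.
- by move=> tau; apply/h.
- by case=> eta [e1 e2]; apply: h6; exists eta; split => // tau; apply/h.
Qed.

(** A form of positive size vanishes at the empty set, so it satisfies the flag automatically. *)
Lemma kclass_succ i k (g : 'I_k -> int) Z j :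
  kclass false i.+1 g Z j <-> kclass true i.+1 g Z j.
Proof.
split=> -[w [[h1 h2 h3] h4 h5 h6]]; exists w; split=> //.
by move=> _ c; rewrite h1 ?cards0 // mxE mcoeff0.
Qed.

Lemma vhom0 k (g : 'I_k -> int) z : vhom g z 0.
Proof. by move=> c; rewrite mxE; exact: homogeneous0. Qed.

Lemma vhom_mulmx k k' (g : 'I_k -> int) (g' : 'I_k' -> int) A z v :
  mxhom g g' A -> vhom g z v -> vhom g' z (v *m A).
Proof.
move=> hA hv c'; rewrite mxE; apply: homogeneous_sum => c _.
by rewrite (_ : z - g' c' = (z - g c) + (g c - g' c')); [exact: homogeneousM | ring].
Qed.

Lemma vhom_kdiff k (g : 'I_k -> int) z (w : {set 'I_n} -> 'rV[S]_k) sg :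
  (forall tau, vhom g (z - 1) (w tau)) -> vhom g z (kdiff w sg).
Proof.
move=> hw c; rewrite summxE; apply: homogeneous_sum => s _.
rewrite mxE -mulrA; apply: homogeneous_sign.
rewrite (_ : z - g c = (mdeg U_(s)%MM)%:Z + (z - 1 - g c)); last by rewrite mdeg1; ring.
by apply: homogeneousM; [exact: homogeneousX | exact: hw].
Qed.

Definition hrow k (g : 'I_k -> int) z (v : 'rV[S]_k) : 'rV[S]_k :=
  \row_c hcomp (z - g c) (v 0 c).

Lemma vhom_hrow k (g : 'I_k -> int) z v : vhom g z (hrow g z v).
Proof. by move=> c; rewrite mxE; exact: homogeneous_hcomp. Qed.

Lemma hrow_id k (g : 'I_k -> int) z v : vhom g z v -> hrow g z v = v.
Proof. by move=> h; apply/rowP => c; rewrite mxE hcomp_id. Qed.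

(** This allows preimages under a homogeneous matrix to be chosen homogeneous. *)
Lemma hrow_mulmx k k' (g : 'I_k -> int) (g' : 'I_k' -> int) A z v :
  mxhom g g' A -> hrow g z v *m A = hrow g' z (v *m A).
Proof.
move=> hA; apply/rowP => c'; rewrite !mxE raddf_sum /=; apply: eq_bigr => c _.
by rewrite (hcompM _ _ (hA c c')) mxE; congr (hcomp _ _ * _); ring.
Qed.

Lemma kdiff0 k (w : {set 'I_n} -> 'rV[S]_k) sg :
  (forall tau, tau != set0 -> w tau = 0) -> kdiff w sg = 0.
Proof.
move=> h; apply: big1 => s hs; rewrite h ?scaler0 //.
by apply/set0Pn; exists s; rewrite setU11.
Qed.

Lemma ev0_kdiff k (w : {set 'I_n} -> 'rV[S]_k) sg c : (kdiff w sg 0 c)@_0%MM = 0.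
Proof. by rewrite kdiffE big1 // => s; rewrite mnm0E eqxx andbF. Qed.

(** The connecting map for the kernel and image of [A], the Koszul complex of the free module
    between them being acyclic up to constants. A cycle in the image is lifted through [A] and
    differentiated; a cycle in the kernel is contracted in the free module and multiplied by [A]. *)
Lemma kclass_shift i k k' (g : 'I_k -> int) (g' : 'I_k' -> int) (A : 'M[S]_(k, k')) j :
  mxhom g g' A ->
  kclass true i.+1 g' (fun v => exists w, v = w *m A) j <->
  kclass true i g (fun w => w *m A = 0) j.
Proof.
move=> hA; split=> -[w [[hsz hh hZ] hcy hc hnb]].
  have [eta0 heta0] := fin_all_exists hZ.
  pose eta (tau : {set 'I_n}) := if #|tau| == i.+1 then hrow g (j - i.+1%:Z) (eta0 tau) else 0.
  have he tau : w tau = eta tau *m A.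
    rewrite /eta; case: ifPn => [_|h]; last by rewrite mul0mx hsz.
    by rewrite (hrow_mulmx _ _ hA) -heta0 hrow_id.
  have hsze (tau : {set 'I_n}) : #|tau| != i.+1 -> eta tau = 0 by rewrite /eta => /negbTE ->.
  exists (kdiff eta); split; [split|..].
  - exact: kdiff_size hsze.
  - move=> tau; apply: vhom_kdiff => {}tau.
    rewrite (_ : j - i%:Z - 1 = j - i.+1%:Z); last by rewrite -addn1 PoszD; ring.
    by rewrite /eta; case: ifP => _; [exact: vhom_hrow | exact: vhom0].
  - by move=> tau; rewrite -kdiff_mulmx -[RHS](hcy tau); apply: eq_kdiff => *; rewrite -he.
  - exact: kdiff_kdiff.
  - by move=> _ c; exact: ev0_kdiff.
  case=> th [hth eth]; apply: hnb.
  (* Clearing the component at the empty set does not change the boundary, and it removes the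
     constant terms that would obstruct acyclicity. *)
  pose th' tau := if tau == set0 then 0 else th tau.
  have eth' sg : kdiff th' sg = kdiff eta sg.
    by rewrite -eth; apply: eq_kdiff => tau /negbTE h; rewrite /th' h.
  have [||z [ez _]] := @koszul_acyclic _ _ k (fun tau => eta tau - th' tau).
  - by move=> sg; rewrite kdiffB eth' subrr.
  - by move=> c; rewrite /th' eqxx hsze ?cards0 // subr0 mxE mcoeff0.
  exists (fun tau => z tau *m A); split; first by move=> tau; exists (z tau).
  move=> sg; rewrite kdiff_mulmx ez mulmxBl -he /th'.
  by case: ifP => _; rewrite ?hth ?mul0mx subr0.
have [|eta [he hm]] := koszul_acyclic hcy; first exact: hc.
have hsze (tau : {set 'I_n}) : #|tau| != i.+1 -> eta tau = 0.
  move=> ht; apply/rowP => c; apply/mpolyP => m; rewrite mxE mcoeff0; apply/eqP.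
  rewrite mcoeff_eq0; apply/negP => /hm[s [hs]].
  rewrite hsz; first by rewrite mxE mcoeff_msupp mcoeff0 eqxx.
  by apply: contra ht => /eqP <-; rewrite -(setD1K hs) cardsU1 !inE eqxx setD1K.
have hhe tau : vhom g (j - i.+1%:Z) (eta tau).
  move=> c m /hm[s [hs /(hh _ c)]]; rewrite mdegD mdeg1; lia.
exists (fun tau => eta tau *m A); split; [split|..].
- by move=> tau h; rewrite hsze // mul0mx.
- by move=> tau; apply: vhom_mulmx.
- by move=> tau; exists (eta tau).
- by move=> sg; rewrite kdiff_mulmx he hZ.
- by move=> _ c; rewrite hsze ?cards0 // mul0mx mxE mcoeff0.
(* If [eta *m A] bounds [z = x *m A], correcting [eta] by [kdiff x] puts it in the kernel without
   changing its boundary [w]. *)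
case=> z [hz ez]; have [x hx] := fin_all_exists hz; apply: hnb.
exists (fun tau => eta tau - kdiff x tau); split.
  move=> tau; rewrite mulmxBl -kdiff_mulmx -ez; apply/eqP; rewrite subr_eq0.
  by apply/eqP/eq_kdiff => *; rewrite -hx.
by move=> sg; rewrite kdiffB kdiff_kdiff subr0 he.
Qed.

(** Modulo the variables, the image of [A] is the cokernel of [B]. A class is recorded by the
    constant terms of a lift through [A]; the flag says that [A] at the origin kills them. *)
Lemma kclass0_tens e k k' k2 (g : 'I_k -> int) (g' : 'I_k' -> int)
    (A : 'M[S]_(k, k')) (B : 'M[S]_(k2, k)) j :
  mxhom g g' A ->
  (forall w : 'rV[S]_k, w *m A = 0 <-> exists w', w = w' *m B) ->
  kclass e 0 g' (fun v => exists w, v = w *m A) j <->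
  exists v : 'rV[K]_k, [/\ forall c, g c != j -> v 0 c = 0,
    e -> v *m map_mx ev0 A = 0 & ~ exists w, v = w *m map_mx ev0 B].
Proof.
move=> hA hB.
have ev_lift k1 (v : 'rV[K]_k1) : map_mx ev0 (map_mx (fun c => c%:MP : S) v) = v.
  by apply/rowP => c; rewrite !mxE mevalC.
have ev0_mx k0 k1 (X : 'M[S]_(k0, k1)) x y : ev0 (X x y) = map_mx ev0 X x y by rewrite mxE.
split.
  case=> w [[hsz hh hZ] hcy hc hnb].
  have [V0 hV0] := hZ set0.
  pose V := hrow g j V0.
  have hV : w set0 = V *m A.
    rewrite (hrow_mulmx _ _ hA) -hV0 hrow_id //.
    by have := hh set0; rewrite subr0.
  exists (map_mx ev0 V); split.
  - move=> c ngc; rewrite mxE meval0_coeff; apply/eqP; rewrite mcoeff_eq0; apply/negP.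
    move/(@vhom_hrow _ g j V0 c); rewrite mdeg0 => /eqP; rewrite eq_sym subr_eq0 eq_sym.
    by rewrite (negbTE ngc).
  - move=> he; rewrite -map_mxM -hV; apply/rowP => c; rewrite !mxE.
    exact: etrans (meval0_coeff _) (hc he c).
  case=> x hx; apply: hnb.
  (* [V] corrected by the image of [B] has no constant terms, hence is a Koszul boundary; [A] does
     not see the correction. *)
  pose D (tau : {set 'I_n}) := if tau == set0 then V - map_mx (fun c => c%:MP) x *m B else 0.
  have [||xi [hxi _]] := @koszul_acyclic _ _ k D.
  - by move=> sg; apply: kdiff0 => tau /negbTE h; rewrite /D h.
  - move=> c; rewrite /D eqxx -meval0_coeff.
    rewrite ev0_mx.
    by rewrite raddfB /= map_mxM ev_lift hx subrr mxE.
  exists (fun tau => xi tau *m A); split; first by move=> tau; exists (xi tau).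
  move=> sg; rewrite kdiff_mulmx hxi /D; case: eqP => [->|/eqP h].
    rewrite mulmxBl -hV (_ : map_mx _ x *m B *m A = 0) ?subr0 //.
    by apply/hB; eexists.
  by rewrite mul0mx hsz // cards_eq0.
case=> v [hg he hnb].
pose V : 'rV[S]_k := map_mx (fun c => c%:MP) v.
have hV : vhom g j V.
  move=> c; rewrite mxE; case: (eqVneq (g c) j) => [->|h].
    by rewrite subrr; apply: homogeneousC.
  by rewrite hg // mpolyC0; apply: homogeneous0.
exists (fun tau => if tau == set0 then V *m A else 0); split; [split|..].
- by move=> tau; rewrite cards_eq0 => /negbTE ->.
- move=> tau; rewrite subr0; case: ifP => _; last exact: vhom0.
  exact: vhom_mulmx hA hV.
- by move=> tau; case: ifP => _; [exists V | exists 0; rewrite mul0mx].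
- by move=> sg; apply: kdiff0 => tau /negbTE ->.
- move=> h c; rewrite eqxx -meval0_coeff.
  rewrite ev0_mx.
  by rewrite map_mxM ev_lift he // mxE.
case=> eta [hZ heta]; apply: hnb.
have [x hx] := fin_all_exists hZ.
(* The corrected lift comes from [B], and evaluation at the origin erases the correction
   [kdiff x]. *)
have /hB[w hw] : (V - kdiff x set0) *m A = 0.
  rewrite mulmxBl -kdiff_mulmx; have := heta set0; rewrite eqxx => <-.
  by apply/eqP; rewrite subr_eq0; apply/eqP/eq_kdiff => *; rewrite -hx.
exists (map_mx ev0 w); rewrite -map_mxM -hw raddfB /= ev_lift.
rewrite (_ : map_mx _ (kdiff _ _) = 0) ?subr0 //.
by apply/rowP => c; rewrite !mxE meval0_coeff ev0_kdiff.
Qed.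

Section Tor.
Variables (r : nat) (f : 'I_r -> int) (M : 'rV[S]_r -> Prop).
Variables (P : free_complex K n r) (HP : graded_free_resolution f M P).

Let aug_hom : mxhom (@gdeg _ _ _ P 0) f (aug P).
Proof. by case: HP => -[]. Qed.
Let diff_hom i : mxhom (@gdeg _ _ _ P i.+1) (@gdeg _ _ _ P i) (diff P i).
Proof. by case: HP => -[_ h] _ _ _; apply: h. Qed.
Let augM v : M v <-> exists w, v = w *m aug P.
Proof. by case: HP. Qed.
Let aug_ex (w : 'rV[S]_(rk P 0)) : w *m aug P = 0 <-> exists w', w = w' *m diff P 0.
Proof. by case: HP. Qed.
Let diff_ex i (w : 'rV[S]_(rk P i.+1)) : w *m diff P i = 0 <-> exists w', w = w' *m diff P i.+1.
Proof. by case: HP. Qed.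

Lemma sub_tens_deg i j m (v : 'M[K]_(m, rk P i)) :
  reflect (forall x c, gdeg c != j -> v x c = 0) (v <= tens_deg P i j)%MS.
Proof.
apply: (iffP submxP) => [[w ->] x c hc|h].
  by rewrite mul_mx_diag !mxE (negbTE hc) mulr0.
exists v; apply/matrixP => x c; rewrite mul_mx_diag !mxE.
by case: eqVneq => [|hc]; rewrite ?mulr1 // mulr0 h.
Qed.

(** A homogeneous entry of nonzero degree has no constant term. *)
Lemma tens_diff_deg i c c' : gdeg c != gdeg c' -> tens_diff P i c c' = 0.
Proof.
move=> h; rewrite mxE meval0_coeff; apply/eqP; rewrite mcoeff_eq0; apply/negP.
by move/(diff_hom (i := i)); rewrite mdeg0 => /eqP; rewrite eq_sym subr_eq0 (negbTE h).
Qed.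

Lemma tens_diff_diff i : tens_diff P i.+1 *m tens_diff P i = 0.
Proof.
rewrite -map_mxM (_ : _ *m _ = 0); first by rewrite map_mx0.
apply/row_matrixP => x; rewrite row_mul row0; apply/diff_ex; exists (delta_mx 0 x).
by rewrite rowE.
Qed.

Lemma boundaries_sub_cycles i j : (boundaries P i j <= cycles P i j)%MS.
Proof.
have hd : (boundaries P i j <= tens_deg P i j)%MS.
  apply/sub_tens_deg => x c hc; rewrite /boundaries mul_diag_mx !mxE.
  case: eqVneq => [e|]; last by rewrite mul0r.
  have := @tens_diff_deg i x c; rewrite mxE => ->; first by rewrite mulr0.
  by rewrite e eq_sym.
case: i hd => [|i] //= hd; rewrite sub_capmx hd; apply/sub_kermxP.
by rewrite -mulmxA tens_diff_diff mulmx0.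
Qed.

Lemma mul_tens_deg i j m (v : 'M[K]_(m, rk P i)) :
  (v <= tens_deg P i j)%MS -> v *m tens_deg P i j = v.
Proof.
move/sub_tens_deg => h; apply/matrixP => x c; rewrite mul_mx_diag !mxE.
by case: eqVneq => [|hc]; rewrite ?mulr1 // mulr0 h.
Qed.

Lemma tens_deg_diff i j :
  tens_deg P i.+1 j *m tens_diff P i = tens_diff P i *m tens_deg P i j.
Proof.
apply/matrixP => x y; rewrite mul_diag_mx mul_mx_diag [LHS]mxE [RHS]mxE !mxE -/(ev0 _).
have := @tens_diff_deg i x y; rewrite mxE.
by case: (eqVneq (gdeg x) (gdeg y)) => [->|_ ->] //; rewrite ?mulr0 ?mul0r // mulrC.
Qed.

Lemma cycles_sub_deg i j : (cycles P i j <= tens_deg P i j)%MS.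
Proof. by case: i => [|i] //=; exact: capmxSl. Qed.

(** Boundaries are cycles, so the ranks agree only if the two spaces do. The differential commutes
    with the degree projections, so a preimage may be sought without restriction on its degree. *)
Lemma tor_dim_neq0 i j : tor_dim P i j <> 0%N <->
  exists v : 'rV[K]_(rk P i), (v <= cycles P i j)%MS /\ ~ exists w, v = w *m tens_diff P i.
Proof.
have -> : tor_dim P i j <> 0%N <-> ~~ (cycles P i j <= boundaries P i j)%MS.
  rewrite -(mxrank_leqif_sup (boundaries_sub_cycles i j)).
  rewrite /tor_dim; split => [h|h].
    by apply/negP => /eqP e; apply: h; rewrite e subnn.
  move=> e; case/negP: h; rewrite eqn_leq (mxrankS (boundaries_sub_cycles i j)) /=.
  by rewrite -subn_eq0 e.
split.
  case/row_subPn => x hx; exists (row x (cycles P i j)); split; first exact: row_sub.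
  case=> w hw; case/negP: hx.
  have /mul_tens_deg <- := submx_trans (row_sub x _) (cycles_sub_deg i j).
  by rewrite hw -mulmxA -tens_deg_diff; exact: submxMl.
case=> v [hv hw]; apply: contra_notN hw => /(submx_trans hv) /submxP[w ->].
by exists (w *m tens_deg P i.+1 j); rewrite /boundaries mulmxA.
Qed.

Lemma sub_cycles i j (v : 'rV[K]_(rk P i)) : (v <= cycles P i j)%MS <->
  (forall c, gdeg c != j -> v 0 c = 0) /\
  (if i is i'.+1 then fun v : 'rV[K]_(rk P i'.+1) => v *m tens_diff P i' = 0
   else fun=> True) v.
Proof.
case: i v => [|i] v /=.
  split=> [/sub_tens_deg h|[h _]]; first by split=> // c; apply: h.
  by apply/sub_tens_deg => x; rewrite ord1; apply: h.
rewrite sub_capmx; split=> [/andP[/sub_tens_deg h /sub_kermxP]|[h /sub_kermxP ->]].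
  by split=> // c; apply: h.
by rewrite andbT; apply/sub_tens_deg => x; rewrite ord1; apply: h.
Qed.

Lemma tor_dim_kclass i j : tor_dim P i j <> 0%N <-> kclass false i f M j.
Proof.
rewrite tor_dim_neq0; case: i => [|i].
  rewrite (eq_kclass _ _ _ _ augM) (kclass0_tens _ _ aug_hom aug_ex).
  by split=> -[v]; [case=> /sub_cycles[]|case]; exists v; rewrite ?sub_cycles.
rewrite kclass_succ (eq_kclass _ _ _ _ augM) (kclass_shift _ _ aug_hom).
rewrite (eq_kclass _ _ _ _ aug_ex).
(* Each step lowers the Koszul degree by one and moves one place up the resolution, until
   homological degree 0 is reached. *)
have shift q : kclass true i (@gdeg _ _ _ P q) (fun v => exists w, v = w *m diff P q) j <->
    kclass true 0 (@gdeg _ _ _ P (q + i)%N) (fun v => exists w, v = w *m diff P (q + i)%N) j.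
  elim: i q => [|i IH] q; first by rewrite addn0.
  rewrite (kclass_shift _ _ (@diff_hom q)) (eq_kclass _ _ _ _ (@diff_ex q)).
  by rewrite IH addSnnS.
rewrite (shift 0%N) add0n.
rewrite (kclass0_tens _ _ (@diff_hom i) (@diff_ex i)).
by split=> -[v]; [case=> /sub_cycles[? ?] ?|case=> ? ? ?]; exists v; rewrite ?sub_cycles; split=> //; split=> //; auto.
Qed.

End Tor.
End Homology.

(** * Koszul homology of squarefree stable submodules *)

Section MonomialIdeals.
Variables (K : fieldType) (n : nat).
Local Notation S := {mpoly K[n]}.
Implicit Types (B : 'X_{1..n} -> Prop) (I : S -> Prop) (m u : 'X_{1..n}).

Lemma mono_idealP B (p : S) :
  mono_ideal B p <-> forall m, m \in msupp p -> exists u, B u /\ (u <= m)%MM.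
Proof.
split.
  case=> s [hs ->]; rewrite big_seq.
  apply: (big_ind (fun p : S => forall m, m \in msupp p -> exists u, B u /\ (u <= m)%MM)).
  - by move=> m; rewrite mcoeff_msupp mcoeff0 eqxx.
  - by move=> x y hx hy m /msuppD_le; rewrite mem_cat => /orP[/hx|/hy].
  move=> ca /hs[u [hu ->]] m /msuppM_le /allpairsP[[m1 m2] /= [_]].
  by rewrite msuppX inE => /eqP -> ->; exists u; split => //; apply: lem_addl.
move=> h; rewrite [p]mpolyE big_seq.
apply: (big_ind (mono_ideal (K := K) B)).
- by exists [::]; split=> //; rewrite big_nil.
- move=> x y [s1 [h1 ->]] [s2 [h2 ->]]; exists (s1 ++ s2); split; last by rewrite big_cat.
  by move=> ca; rewrite mem_cat => /orP[/h1|/h2].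
move=> m /h[u [hu le]]; exists [:: (p@_m *: 'X_[m - u], 'X_[u])]; split.
  by move=> ca; rewrite inE => /eqP -> /=; exists u.
by rewrite big_seq1 /= -scalerAl -mpolyXD submK.
Qed.

Lemma mono_idealX B m : mono_ideal B ('X_[m] : S) <-> exists u, B u /\ (u <= m)%MM.
Proof.
rewrite mono_idealP; split; first by apply; rewrite msuppX inE.
by move=> h m'; rewrite msuppX inE => /eqP ->.
Qed.

Section OneIdeal.
Variables (I : S -> Prop) (hI : sqfree_monomial_ideal I).

Lemma sqfree_ideal_msupp p : I p <-> forall m, m \in msupp p -> I 'X_[m].
Proof.
have [B [_ hB]] := hI; rewrite hB mono_idealP.
by split=> h m /h; rewrite hB mono_idealX.
Qed.

Lemma sqfree_ideal_le m m' : (m <= m')%MM -> I 'X_[m] -> I 'X_[m'].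
Proof.
have [B [_ hB]] := hI; rewrite !hB !mono_idealX => le [u [hu lu]].
by exists u; split=> //; apply: lepm_trans le.
Qed.

(** A squarefree generator dividing [m] contains x_s at most once, so it still divides after one
    copy is removed. *)
Lemma sqfree_ideal_div m s : (1 < m s)%N -> I 'X_[m] -> I 'X_[m - U_(s)].
Proof.
have [B [hsq hB]] := hI; rewrite !hB !mono_idealX => hm [u [hu lu]].
exists u; split=> //; apply/mnm_lepP => t; rewrite mnmBE mnm1E.
have := mnm_lepP lu t; have := hsq _ hu t.
by case: eqP => [<-|_]; lia.
Qed.

Lemma sqfree_ideal_proper : (exists p, ~ I p) -> ~ I 'X_[0%MM].
Proof.
case=> p np h0; apply: np; apply/sqfree_ideal_msupp => m _.
by apply: sqfree_ideal_le h0; apply/mnm_lepP => i; rewrite mnm0E.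
Qed.

(** Restates minimality of a generating set as minimality under division by one variable, the form
    in which it meets the Koszul differential. *)
Lemma in_GP u : in_G I u <-> I 'X_[u] /\ forall s, u s != 0%N -> ~ I 'X_[u - U_(s)].
Proof.
split.
  case=> B [[hB hmin] hu]; split; first by rewrite hB mono_idealX; exists u; rewrite lepm_refl.
  move=> s hs; rewrite hB mono_idealX => -[v [hv lv]].
  have nvu : v <> u.
    move=> e; have := mnm_lepP lv s; rewrite e mnmBE mnm1E eqxx.
    by move: hs; lia.
  have gen p : I p <-> mono_ideal (fun w => B w /\ w <> u) p.
    rewrite hB !mono_idealP; split=> h m /h[w [hw lw]]; last by case: hw; exists w.
    case: (eqVneq w u) => [e|/eqP ne]; last by exists w.
    exists v; split=> //; apply: (lepm_trans lv); apply: (lepm_trans (lem_subr _ _)).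
    by rewrite -e.
  by have [] := hmin _ (fun w => @proj1 _ _) gen u hu.
move=> [hu hmin].
pose B v := I 'X_[v] /\ forall s, v s != 0%N -> ~ I 'X_[v - U_(s)].
have gen m : I 'X_[m] -> exists v, B v /\ (v <= m)%MM.
  elim: (mdeg m) {-2}m (leqnn (mdeg m)) => {m} [|d IH] m hd hm.
    exists m; split; last exact: lepm_refl.
    split=> // s; move: hd; rewrite leqn0 mdeg_eq0 => /eqP ->.
    by rewrite mnm0E.
  case: (classic (exists s, m s != 0%N /\ I 'X_[m - U_(s)])) => [[s [hs hI']]|no].
    have [|v [hv lv]] := IH (m - U_(s))%MM _ hI'.
      by move: hd; rewrite -{1}(@submK _ U_(s) m) ?lep1mP // mdegD mdeg1; lia.
    by exists v; split=> //; exact: lepm_trans lv (lem_subr _ _).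
  exists m; split; last exact: lepm_refl.
  by split=> // s hs hI'; apply: no; exists s.
exists B; split; last by split.
have IB p : I p <-> mono_ideal B p.
  rewrite mono_idealP sqfree_ideal_msupp; split=> h m /h; first exact: gen.
  by case=> v [[hv _] lv]; apply: sqfree_ideal_le hv.
split=> // B' sub hB' v [hv hvm].
(* Some [w] in [B'] divides [v]; were the division proper, some v/x_s would be in the ideal. *)
move: (hv); rewrite hB' mono_idealX => -[w [hw lw]].
suff -> : v = w by [].
apply/mnmP => s; apply/eqP; rewrite eqn_leq (mnm_lepP lw s) andbT leqNgt; apply/negP => lt.
apply: (hvm s); first by rewrite -lt0n; apply: leq_trans lt.
case: (sub _ hw) => hIw _; apply: sqfree_ideal_le hIw.
apply/mnm_lepP => t; rewrite mnmBE mnm1E; have := mnm_lepP lw t.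
by case: eqP => [<-|_]; lia.
Qed.

End OneIdeal.
End MonomialIdeals.

Section MaxIndex.
Variable n : nat.
Implicit Types (m u : 'X_{1..n}).

Lemma leq_mmax m (s : 'I_n) : m s != 0%N -> (s < mmax m)%N.
Proof.
move=> h; have hs : s \in supp m by rewrite inE.
exact: (@leq_bigmax_cond _ (fun s => s \in supp m) (fun s : 'I_n => s.+1) s hs).
Qed.

Lemma mmaxP m : m <> 0%MM -> exists s : 'I_n, mmax m = s.+1 /\ m s != 0%N.
Proof.
move=> nz; have [s hs] : exists s, s \in supp m.
  apply/set0Pn/eqP => e; apply: nz; apply/mnmP => s; rewrite mnm0E.
  by move/setP/(_ s): e; rewrite !inE => /negbT/negPn/eqP.
rewrite /mmax.
have [|t ht ->] := @eq_bigmax_cond _ (mem (supp m)) (fun s : 'I_n => s.+1).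
  by apply/card_gt0P; exists s.
by exists t; split=> //; move: ht; rewrite inE.
Qed.

Lemma mmax_eq m (s : 'I_n) : m s != 0%N -> (forall t, m t != 0%N -> (t <= s)%N) -> mmax m = s.+1.
Proof.
move=> hs h; apply/eqP; rewrite eqn_leq leq_mmax // andbT.
by apply/bigmax_leqP => t; rewrite inE => /h.
Qed.

Lemma sum_ltn d : (\sum_(t < n) (t < d) = minn n d)%N.
Proof.
elim: n => [|k IH]; first by rewrite big_ord0 min0n.
by rewrite big_ord_recr /= IH; lia.
Qed.

Lemma mdeg_le_mmax m : sqfree m -> (mdeg m <= mmax m)%N.
Proof.
move=> h; apply: (@leq_trans (\sum_(t < n) (t < mmax m))); last by rewrite sum_ltn geq_minr.
rewrite mdegE; apply: leq_sum => t _; have := h t; have := @leq_mmax m t.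
by case: (m t) => [|[|]] // -> .
Qed.

Lemma ex_subset_card (A : {set 'I_n}) d : (d <= #|A|)%N -> exists sg : {set 'I_n}, sg \subset A /\ #|sg| = d.
Proof.
move=> h; exists [set x in take d (enum A)]; split.
  by apply/subsetP => x; rewrite inE => /mem_take; rewrite mem_enum.
rewrite cardsE; have /card_uniqP -> : uniq (take d (enum A)) by rewrite take_uniq ?enum_uniq.
by rewrite size_take -cardE; case: ltngtP h.
Qed.

End MaxIndex.

Section Stable.
Variables (K : fieldType) (n r : nat) (f : 'I_r -> int).
Local Notation S := {mpoly K[n]}.
Variables (I : 'I_r -> S -> Prop) (M : 'rV[S]_r -> Prop) (hM : sqfree_stable f I M).

Let MI v : M v <-> forall a, I a (v 0 a).
Proof. by case: hM => -[]. Qed.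
Let sqI a : sqfree_monomial_ideal (I a).
Proof. by case: hM => -[_ /(_ a)[]]. Qed.
Let properI a : ~ I a 'X_[0%MM].
Proof. by case: hM => -[_ /(_ a)[h1 h2]] _ _; apply: sqfree_ideal_proper. Qed.

Lemma mono_eltP u a : M (mono_elt K u a) <-> I a 'X_[u].
Proof.
rewrite MI; split=> [/(_ a)|h b]; first by rewrite !mxE !eqxx mulr1.
rewrite !mxE eqxx /=; case: eqVneq => [->|_]; first by rewrite mulr1.
by rewrite mulr0; apply/(sqfree_ideal_msupp (sqI b)) => m; rewrite mcoeff_msupp mcoeff0 eqxx.
Qed.

Lemma stable_exchange a u (s t : 'I_n) : sqfree u -> I a 'X_[u] -> mmax u = s.+1 ->
  (t < s)%N -> u t = 0%N -> I a 'X_[U_(t) + (u - U_(s))].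
Proof.
move=> hu hI hs hts ht; case: hM => _ h _; apply/mono_eltP/h => //; first exact/mono_eltP.
by rewrite inE ht.
Qed.

(** The homotopy of [koszul_contract] bounds every cycle if its coefficients stay in [M]; they can
    leave [M] only at a term of [w] that is a minimal generator with large enough [mmax]. *)
Lemma kclass_stable_sub i j : kclass false i f M (i%:Z + j) ->
  exists a u, in_GM f I j u a /\ i%:Z + j <= (mmax u)%:Z + f a.
Proof.
case=> w [[hsz hh hZ] hcy _ hnb]; apply: NNPP => no; apply: hnb.
have hI tau a m : m \in msupp (w tau 0 a) -> I a 'X_[m].
  by have /MI/(_ a)/(sqfree_ideal_msupp (sqI a)) := hZ tau; apply.
pose q (m : 'X_{1..n}) : option 'I_n :=
  if [pick s | (1 < m s)%N] is Some s then Some s else [pick s : 'I_n | mmax m == s.+1].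
have [||eta [he hm]] := @koszul_contract _ _ _ w q; first exact: hcy.
  move=> tau a m hm; rewrite /q; case: pickP => [s hs|_].
    by exists s; split=> //; rewrite -lt0n; apply: leq_trans hs.
  have [|s [hs hs']] := @mmaxP _ (m + mset tau)%MM.
    move=> e; apply: (@properI a).
    apply: (sqfree_ideal_le (sqI a)) (hI _ _ _ hm).
    by rewrite -e; apply: lem_addr.
  case: pickP => [t /eqP ht|/(_ s)]; last by rewrite hs eqxx.
  by exists s; split=> //; congr Some; apply: val_inj; move: ht; rewrite hs => -[].
exists eta; split=> // tau; apply/MI => a; apply/(sqfree_ideal_msupp (sqI a)) => m.
move/hm => [s [hq hs hm']].
set m' := (m + U_(s))%MM in hm'.
have Im' := hI _ _ _ hm'.
have em : (m' - U_(s) = m)%MM by rewrite /m' addmK.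
have ht : #|tau :\ s| = i.
  apply/eqP/contraT => /hsz e; move: hm'.
  by rewrite e mxE mcoeff_msupp mcoeff0 eqxx.
have hd : (mdeg m')%:Z = j - f a by rewrite (hh _ _ _ hm'); ring.
have ea : (m + mset tau = m' + mset (tau :\ s))%MM.
  by rewrite /m' -addmA -msetU1 ?inE ?eqxx // setD1K.
rewrite -em; move: hq; rewrite ea /q; case: pickP => [s' hs' [e]|no2].
  (* Since [s] is not in [tau :\ s], the exponent of at least 2 already occurs in [m']. *)
  rewrite {}e in hs'; apply: (sqfree_ideal_div (sqI a)) Im'.
  by move: hs'; rewrite mnmDE [mset _ s]mnmE !inE eqxx addn0.
have sqa : sqfree (m' + mset (tau :\ s)) by move=> t; rewrite leqNgt no2.
have sqm' : sqfree m' by move=> t; have := sqa t; rewrite mnmDE; lia.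
case: pickP => // s' /eqP hmax [e]; rewrite {}e {s'} in hmax.
have m's : m' s != 0%N by rewrite mnmDE mnm1E eqxx addn1.
have hmax' : mmax m' = s.+1.
  apply: mmax_eq => // t h; rewrite -ltnS -hmax; apply: leq_mmax.
  by rewrite mnmDE; lia.
(* If no such [t] exists, [m'] is a minimal generator. The multidegree is squarefree with the same
   last variable, so its degree [mdeg m' + i] is at most [mmax m'], against [no]. *)
case: (classic (exists t, m' t != 0%N /\ I a 'X_[m' - U_(t)])) => [[t [h1 h2]]|no3]; last first.
  case: no; exists a, m'; split; first split=> //.
    by apply/(in_GP (sqI a)); split=> // t h1 h2; apply: no3; exists t.
  have := mdeg_le_mmax sqa; rewrite hmax hmax' mdegD mdeg_mset ht; lia.
case: (eqVneq t s) => [<- //|nts].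
have lts : (t < s)%N.
  by have := leq_mmax h1; rewrite hmax' ltnS leq_eqVlt (inj_eq val_inj) (negbTE nts).
(* m'/x_s arises from m'/x_t, whose last variable is still x_s, by exchanging x_s for x_t. *)
have -> : (m' - U_(s) = U_(t) + ((m' - U_(t)) - U_(s)))%MM.
  apply/mnmP => x; rewrite mnmBE mnmDE !mnmBE !mnm1E; case: (eqVneq t x) => [<-|_]; last by rewrite subn0.
  by rewrite eq_sym (negbTE nts) !subn0 subnKC // lt0n.
apply: stable_exchange => //.
- by move=> x; rewrite mnmBE; have := sqm' x; lia.
- apply: mmax_eq; first by rewrite mnmBE mnm1E (negbTE nts) subn0.
  move=> x; rewrite mnmBE -ltnS -hmax' => h; apply: leq_mmax; lia.
by rewrite mnmBE mnm1E eqxx; have := sqm' t; lia.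
Qed.

Lemma kclass_stable_sup i j a u : in_GM f I j u a -> i%:Z + j <= (mmax u)%:Z + f a ->
  kclass false i f M (i%:Z + j).
Proof.
move=> [/(in_GP (sqI a))[Iu hmin] hd] hle.
have nz : u <> 0%MM by move=> e; apply: (@properI a); rewrite -e.
have squ : sqfree u.
  move=> t; rewrite leqNgt; apply/negP => h; apply: (hmin t); first by lia.
  exact: (sqfree_ideal_div (sqI a)).
have [s [hs us]] := mmaxP nz.
pose A := [set t : 'I_n | (t < s)%N && (u t == 0%N)].
(* Every index up to [s] lies in [A] or divides [u]; hence [A] has at least [mmax u - mdeg u]
   elements, which is at least [i] by [hle] and [hd]. *)
have cA : (s + 1 <= #|A| + mdeg u)%N.
  rewrite -sum1_card big_mkcond mdegE -big_split /=.
  have -> : (s + 1 = \sum_(t < n) ((t < s) + (t == s)))%N.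
    rewrite big_split /= sum_ltn (bigD1 s) //= eqxx big1; last by move=> t /negbTE ->.
    by have := ltn_ord s; lia.
  apply: leq_sum => t _; rewrite inE; case: (eqVneq t s) => [->|_].
    by rewrite ltnn /= lt0n.
  by case: (t < s)%N; case: (u t).
have [sg [sub csg]] : exists sg : {set 'I_n}, sg \subset A /\ #|sg| = i.
  apply: ex_subset_card; move: cA hle; rewrite hs; move: #|A| => cA; lia.
have sgP t : t \in sg -> (t < s)%N /\ u t = 0%N.
  by move/(subsetP sub); rewrite inE => /andP[? /eqP].
have nsg : s \notin sg by apply/negP => /sgP[]; rewrite ltnn.
pose c tau : 'rV[S]_r := if tau == s |: sg then mono_elt K (u - U_(s)) a else 0.
have cP tau b m : (c tau 0 b)@_m != 0 -> [/\ tau = s |: sg, b = a & m = (u - U_(s))%MM].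
  rewrite /c; case: (eqVneq tau) => [->|_]; last by rewrite mxE mcoeff0 eqxx.
  rewrite !mxE eqxx /=; case: (eqVneq b a) => [->|_]; last by rewrite mulr0 mcoeff0 eqxx.
  by rewrite mulr1 mcoeffX; case: (eqVneq (u - U_(s))%MM m) => [->|]; rewrite ?eqxx.
exists (kdiff c); split.
- split.
  + apply: kdiff_size => tau ht; apply/rowP => b; apply/mpolyP => m; rewrite mxE mcoeff0.
    by apply/eqP/contraT => /cP[e _ _]; move: ht; rewrite e cardsU1 nsg csg eqxx.
  + move=> tau; apply: vhom_kdiff => {}tau b m; rewrite mcoeff_msupp => /cP[_ -> ->].
    by move: hd; rewrite -{1}(@submK _ U_(s) u) ?lep1mP // mdegD mdeg1; lia.
  move=> tau; apply/MI => b; apply/(sqfree_ideal_msupp (sqI b)) => m.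
  rewrite mcoeff_msupp kdiffE => h.
  have [t /andP[ht hmt] ht'] : exists2 t, (t \notin tau) && (m t != 0%N)
      & (c (t |: tau) 0 b)@_(m - U_(t))%MM != 0.
    apply/exists_inP; apply: contraT; rewrite negb_exists_in => /forall_inP h'.
    case/eqP: h; apply: big1 => t ht; have /negPn/eqP -> := h' t ht.
    by rewrite mulr0.
  have [e -> em] := cP _ _ _ ht'.
  have -> : m = (U_(t) + (u - U_(s)))%MM by rewrite -em addmC submK ?lep1mP.
  (* The boundary gives [u] for [t = s], and x_t u/x_s for [t] in [sg], which stability keeps in the
     ideal. *)
  have : t \in s |: sg by rewrite -e setU11.
  rewrite !inE => /orP[/eqP ->|/sgP[lts ut]]; first by rewrite addmC submK ?lep1mP.
  exact: stable_exchange.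
- exact: kdiff_kdiff.
- by [].
case=> eta [hZ heta].
(* A contribution to this coefficient would need some u/x_t in [I a]; but in [kdiff c] it is a sign,
   coming from [t = s]. *)
have : (kdiff eta sg 0 a)@_u = 0.
  rewrite kdiffE big1 // => t /andP[_ ut]; rewrite [X in _ * X](_ : _ = 0) ?mulr0 //.
  apply/eqP; rewrite mcoeff_eq0; apply/negP => h; apply: (hmin t ut).
  by have /MI/(_ a)/(sqfree_ideal_msupp (sqI a)) := hZ (t |: sg); apply.
rewrite heta kdiffE (bigD1 s) /=; last by rewrite nsg.
rewrite big1 ?addr0; last first.
  move=> t /andP[/andP[ht _] nts]; rewrite [X in _ * X](_ : _ = 0) ?mulr0 //.
  apply/eqP/contraT => /cP[e _ _]; have : t \in s |: sg by rewrite -e setU11.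
  by rewrite !inE (negbTE nts) (negbTE ht).
rewrite /c eqxx !mxE !eqxx mulr1 mcoeffX eqxx mulr1 => /eqP.
by rewrite signr_eq0.
Qed.

End Stable.

(** * Existence of graded free resolutions *)

(** Induction on the list of variables. The list [s0] obtained for [l] covers all elements whose
    exponent at [q] reaches the maximum occurring in [s0]; each of the finitely many smaller
    exponents gives a slice covered by induction. *)
Lemma dickson_on n (l : seq 'I_n) (P : 'X_{1..n} -> Prop) :
  exists s : seq 'X_{1..n}, (forall u, u \in s -> P u) /\
    forall m, P m -> exists u, u \in s /\ forall q, q \in l -> (u q <= m q)%N.
Proof.
elim: l P => [|q l IH] P.
  case: (classic (exists m, P m)) => [[m hm]|no].
    exists [:: m]; split=> [u|m' _]; first by rewrite inE => /eqP ->.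
    by exists m; rewrite inE eqxx.
  by exists [::]; split=> // m hm; case: no; exists m.
have [s0 [hs0 cov0]] := IH P.
have [s1 [hs1 cov1]] : exists s1 : seq 'X_{1..n}, (forall u, u \in s1 -> P u) /\
    forall m, P m -> (m q < \max_(u <- s0) u q)%N ->
      exists u, u \in s1 /\ forall x, x \in q :: l -> (u x <= m x)%N.
  elim: (\max_(u <- s0) u q)%N => [|d [s1 [h1 c1]]]; first by exists [::].
  have [s2 [h2 c2]] := IH (fun m => P m /\ m q = d).
  exists (s1 ++ s2); split=> [u|m hm]; first by rewrite mem_cat => /orP[/h1|/h2[]].
  rewrite ltnS leq_eqVlt => /orP[/eqP e|lt].
    have [//|u [hu le]] := c2 m; exists u; rewrite mem_cat hu orbT; split=> // x.
    by rewrite inE => /orP[/eqP ->|/le //]; case: (h2 _ hu) => _ ->; rewrite e.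
  by have [u [hu le]] := c1 m hm lt; exists u; rewrite mem_cat hu.
exists (s0 ++ s1); split=> [u|m hm]; first by rewrite mem_cat => /orP[/hs0|/hs1].
case: (ltnP (m q) (\max_(u <- s0) u q)) => h.
  by have [u [hu le]] := cov1 m hm h; exists u; rewrite mem_cat hu orbT.
have [u [hu le]] := cov0 m hm; exists u; rewrite mem_cat hu; split=> // x.
rewrite inE => /orP[/eqP ->|/le //]; apply: leq_trans h.
by rewrite (big_rem u) //= leq_maxl.
Qed.

Lemma dickson n (P : 'X_{1..n} -> Prop) :
  exists s : seq 'X_{1..n}, (forall u, u \in s -> P u) /\
    forall m, P m -> exists u, u \in s /\ (u <= m)%MM.
Proof.
have [s [h1 h2]] := dickson_on (enum 'I_n) P; exists s; split=> // m /h2[u [hu le]].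
by exists u; split=> //; apply/mnm_lepP => q; apply: le; rewrite mem_enum.
Qed.

Section Noether.
Variables (K : fieldType) (n : nat).
Local Notation S := {mpoly K[n]}.

Lemma mlead_cancel (p q : S) : q != 0 -> (mlead q <= mlead p)%MM ->
  let p' := p - (mleadc p / mleadc q) *: 'X_[mlead p - mlead q] * q in
  p' != 0 -> (mlead p' < mlead p)%O.
Proof.
move=> nq le p' np'.
have e : (mlead p - mlead q + mlead q = mlead p)%MM by rewrite submK.
have nlq : mleadc q != 0 by rewrite mleadc_eq0.
have cq : (p'@_(mlead p)) = 0.
  rewrite mcoeffB -scalerAl mcoeffZ mcoeffXM lem_subr submBA // [(mlead p + _)%MM]addmC addmK.
  by rewrite divfK ?subrr.
rewrite lt_neqAle; apply/andP; split.
  by apply: contra_neqN np' => /eqP e'; apply/eqP; rewrite -mleadc_eq0 e' cq.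
have [z|nc] := eqVneq (mleadc p / mleadc q) 0.
  by rewrite /p' z scale0r mul0r subr0.
apply: (le_trans (mleadB_le _ _)); rewrite -scalerAl mleadZ // mleadM ?mleadXm //.
  by rewrite e joinxx.
by rewrite -msupp_eq0 msuppX.
Qed.

(** Leading monomials of a graded submodule are thus attained by homogeneous elements. *)
Lemma mlead_hcomp (p : S) : p != 0 ->
  hcomp (mdeg (mlead p))%:Z p != 0 /\ mlead (hcomp (mdeg (mlead p))%:Z p) = mlead p.
Proof.
move=> np; have h : mlead p \in msupp (hcomp (mdeg (mlead p))%:Z p).
  by rewrite mcoeff_msupp mcoeff_hcomp eqxx mleadc_eq0.
have nz : hcomp (mdeg (mlead p))%:Z p != 0.
  by apply: contraTneq h => ->; rewrite mcoeff_msupp mcoeff0 eqxx.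
split=> //; apply/eqP; rewrite eq_le msupp_le_mlead ?msupp_le_mlead //.
exact: msupp_hcomp (mlead_supp nz).
Qed.

Definition graded_submodule k (g : 'I_k -> int) (Z : 'rV[S]_k -> Prop) : Prop :=
  [/\ Z 0, forall p v w, Z v -> Z w -> Z (p *: v + w) &
      forall z v, Z v -> Z (hrow g z v)].

Record gens (k : nat) := Gens {
  gnum : nat;
  gdg : 'I_gnum -> int;
  gmx : 'M[S]_(gnum, k)
}.

Definition generates k (g : 'I_k -> int) (Z : 'rV[S]_k -> Prop) (G : gens k) : Prop :=
  mxhom (@gdg _ G) g (gmx G) /\ forall v, Z v <-> exists w, v = w *m gmx G.

(* Leading terms are taken position over term: first nonzero coordinate, then
   leading monomial. *)
Theorem graded_noether k (g : 'I_k -> int) Z :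
  graded_submodule g Z -> exists G, generates g Z G.
Proof.
case=> Z0 Zlin Zh.
pose lead (c : 'I_k) (vz : 'rV[S]_k * int) m :=
  [/\ Z vz.1, vhom g vz.2 vz.1, forall c' : 'I_k, (c' < c)%N -> vz.1 0 c' = 0,
      vz.1 0 c != 0 & mlead (vz.1 0 c) = m].
have /fin_all_exists[gc hgc] : forall c : 'I_k, exists gs : seq ('rV[S]_k * int),
    (forall y, y \in gs -> Z y.1 /\ vhom g y.2 y.1) /\
    forall m, (exists vz, lead c vz m) ->
      exists y m', [/\ y \in gs, lead c y m' & (m' <= m)%MM].
  move=> c; have [s [hs cov]] := dickson (fun m => exists vz, lead c vz m).
  have [gs [h1 h2]] : exists gs : seq ('rV[S]_k * int),
      (forall y, y \in gs -> Z y.1 /\ vhom g y.2 y.1) /\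
      forall m, m \in s -> exists y, y \in gs /\ lead c y m.
    elim: s hs {cov} => [|m s IH] hs; first by exists [::].
    have [|gs [h1 h2]] := IH; first by move=> u hu; apply: hs; rewrite inE hu orbT.
    have [|y hy] := hs m; first by rewrite inE eqxx.
    exists (y :: gs); split=> [y'|m'].
      by rewrite inE => /orP[/eqP ->|/h1 //]; case: hy.
    rewrite inE => /orP[/eqP ->|/h2[y' [e1 e2]]]; first by exists y; rewrite inE eqxx.
    by exists y'; rewrite inE e1 orbT.
  exists gs; split=> // m /cov[u [/h2[y [e1 e2]] le]].
  by exists y, u.
pose gs := flatten [seq gc c | c <- enum 'I_k].
have gsP c y : y \in gc c -> y \in gs.
  by move=> h; apply/flattenP; exists (gc c) => //; apply/mapP; exists c; rewrite ?mem_enum.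
have gsZ y : y \in gs -> Z y.1 /\ vhom g y.2 y.1.
  by case/flattenP => l /mapP[c _ ->]; case: (hgc c) => h _; apply: h.
pose A : 'M[S]_(size gs, k) := \matrix_i (tnth (in_tuple gs) i).1.
exists (@Gens _ (size gs) (fun i => (tnth (in_tuple gs) i).2) A); split=> /=.
  by move=> i c; rewrite mxE; have [_ h] := gsZ _ (mem_tnth i (in_tuple gs)); apply: h.
move=> v; split; last first.
  case=> w ->; rewrite mulmx_sum_row; apply: big_ind => //.
    by move=> x y hx hy; rewrite -[x]scale1r; apply: Zlin.
  move=> i _; rewrite -[_ *: _]addr0; apply: Zlin => //; rewrite rowK.
  by case: (gsZ _ (mem_tnth i (in_tuple gs))).
(* Division with remainder: [d] bounds the number of coordinates still to be cleared, and within one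
   coordinate the leading monomial decreases. *)
have red d (c : nat) : (k <= c + d)%N -> forall v, Z v ->
    (forall c' : 'I_k, (c' < c)%N -> v 0 c' = 0) -> exists w, v = w *m A.
  elim: d c => [|d IH] c hc {}v.
    move=> _ h; exists 0; rewrite mul0mx; apply/rowP => c'; rewrite mxE h //.
    by apply: leq_trans (ltn_ord c') _; rewrite addn0 in hc.
  case: (ltnP c k) => hck; last first.
    by move=> Zv h; apply: (IH c) => //; lia.
  pose c0 := Ordinal hck.
  have H0 u : Z u -> (forall c' : 'I_k, (c' < c)%N -> u 0 c' = 0) -> u 0 c0 = 0 ->
      exists w, u = w *m A.
    move=> Zu h h0; apply: (IH c.+1); [lia | done |] => c'.
    rewrite ltnS leq_eqVlt => /orP[/eqP e|/h //].
    by rewrite (_ : c' = c0) //; apply: val_inj.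
  move=> Zv hv; case: (eqVneq (v 0 c0) 0) => [|nz]; first exact: H0.
  move em: (mlead (v 0 c0)) => m.
  elim/(well_founded_ind (@ltom_wf n)): m v Zv hv nz em => m IHm {}v Zv hv nz em.
  (* [v] need not be homogeneous, so the covering is applied to its component that carries the
     leading monomial. *)
  have [_ cov] := hgc c0; have [|y [m' [hy [Zy hhy y0 ny ey] le]]] := cov m.
    pose z := (mdeg m)%:Z + g c0.
    exists (hrow g z v, z); have ez : z - g c0 = mdeg m by rewrite /z addrK.
    have := mlead_hcomp nz; rewrite em => -[h1 h2].
    split=> /=; [exact: Zh | exact: vhom_hrow | | by rewrite mxE ez | by rewrite mxE ez].
    by move=> c' /hv h; rewrite mxE h raddf0.
  have /tnthP[i hi] : y \in in_tuple gs by exact: gsP hy.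
  have ryi : row i A = y.1 by rewrite rowK hi.
  rewrite -em -ey in le.
  pose a : S := (mleadc (v 0 c0) / mleadc (y.1 0 c0)) *: 'X_[mlead (v 0 c0) - mlead (y.1 0 c0)].
  pose u : 'rV[S]_k := - a *: y.1 + v.
  suff [w hw] : exists w, u = w *m A.
    exists (w + a *: delta_mx 0 i); rewrite mulmxDl -hw -scalemxAl -rowE ryi /u scaleNr.
    by rewrite addrAC addNr add0r.
  have Zu : Z u by apply: Zlin.
  have hu (c' : 'I_k) : (c' < c)%N -> u 0 c' = 0 by move=> h; rewrite !mxE hv // y0 // mulr0 addr0.
  have uc : u 0 c0 = v 0 c0 - a * y.1 0 c0 by rewrite !mxE mulNr addrC.
  case: (eqVneq (u 0 c0) 0) => [|nu]; first exact: H0.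
  apply: (IHm (mlead (u 0 c0))) => //; rewrite -em.
  by rewrite uc in nu *; exact: mlead_cancel ny le nu.
by move=> Zv; apply: (red k 0%N).
Qed.

Lemma graded_ker k k' (g : 'I_k -> int) (g' : 'I_k' -> int) (A : 'M[S]_(k, k')) :
  mxhom g g' A -> graded_submodule g (fun v => v *m A = 0).
Proof.
move=> hA; split; first by rewrite mul0mx.
  by move=> p v w hv hw; rewrite mulmxDl -scalemxAl hv hw scaler0 addr0.
by move=> z v hv; rewrite (hrow_mulmx _ _ hA) hv; apply/rowP => c; rewrite !mxE raddf0.
Qed.

Section Resolution.
Variables (r : nat) (f : 'I_r -> int) (M : 'rV[S]_r -> Prop).
Hypothesis gM : graded_submodule f M.

(** The ambient rank changes at each syzygy; bundling it keeps the iteration within one type. *)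
Record stage := Stage { srk : nat; sgens : gens srk }.

Definition gens0 k : gens k := @Gens k 0 (fun=> 0) 0.

Definition next_stage (s : stage) : stage :=
  @Stage (gnum (sgens s)) (epsilon (inhabits (gens0 (gnum (sgens s))))
    (generates (@gdg _ (sgens s)) (fun v => v *m gmx (sgens s) = 0))).

Definition stage0 : stage := @Stage r (epsilon (inhabits (gens0 r)) (generates f M)).

Definition syzygies (i : nat) : stage := iter i next_stage stage0.

Definition syzygy_complex : free_complex K n r :=
  @FreeComplex K n r (fun i => gnum (sgens (syzygies i)))
    (fun i => @gdg _ (sgens (syzygies i)))
    (fun i => gmx (sgens (syzygies i.+1)))
    (gmx (sgens (syzygies 0))).

Lemma stage0P : generates f M (sgens stage0).
Proof. exact: epsilon_spec (graded_noether gM). Qed.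

Lemma next_stageP s g : mxhom (@gdg _ (sgens s)) g (gmx (sgens s)) ->
  generates (@gdg _ (sgens s)) (fun v => v *m gmx (sgens s) = 0) (sgens (next_stage s)).
Proof. by move=> h; apply: epsilon_spec; apply: graded_noether; apply: graded_ker h. Qed.

(** Homogeneity makes the next kernel graded. The column degrees are [f] at first and those of the
    previous generators later, whence the existential. *)
Lemma syzygiesP i : exists g, mxhom (@gdg _ (sgens (syzygies i))) g (gmx (sgens (syzygies i))).
Proof.
elim: i => [|i [g /next_stageP[h _]]]; first by exists f; case: stage0P.
by eexists; exact: h.
Qed.

Theorem graded_free_resolution_exists : exists P, graded_free_resolution f M P.
Proof.
exists syzygy_complex.
have step i : generates (@gdg _ (sgens (syzygies i)))
    (fun v => v *m gmx (sgens (syzygies i)) = 0) (sgens (syzygies i.+1)).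
  by have [g] := syzygiesP i; exact: next_stageP.
split.
- split; first by case: stage0P.
  by move=> i; case: (step i).
- by case: stage0P.
- by case: (step 0%N).
- by move=> i; case: (step i.+1).
Qed.

End Resolution.
End Noether.

(** * Nonvanishing and extremal Betti numbers *)

Section Main.
Variables (K : fieldType) (n r : nat) (f : 'I_r -> int).
Local Notation S := {mpoly K[n]}.
Variables (I : 'I_r -> S -> Prop) (M : 'rV[S]_r -> Prop) (hM : sqfree_stable f I M).

Lemma graded_stable : graded_submodule f M.
Proof.
have [[MI sqI] _ _] := hM.
have IP a p : I a p <-> forall m, m \in msupp p -> I a 'X_[m].
  by case: (sqI a) => h _; exact: sqfree_ideal_msupp.
split.
- by apply/MI => a; apply/IP => m; rewrite mxE mcoeff_msupp mcoeff0 eqxx.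
- move=> p v w /MI hv /MI hw; apply/MI => a; apply/IP => m; rewrite !mxE.
  move/msuppD_le; rewrite mem_cat => /orP[|hm]; last exact: (proj1 (IP a _)) (hw a) _ hm.
  move/msuppM_le/allpairsP => [[m1 m2] /= [_ h ->]].
  apply: (@sqfree_ideal_le _ _ _ (proj1 (sqI a)) m2); first exact: lem_addl.
  exact: (proj1 (IP a _)) (hv a) _ h.
- move=> z v /MI hv; apply/MI => a; apply/IP => m; rewrite mxE => /msupp_hcomp.
  exact: (proj1 (IP a _)) (hv a) m.
Qed.

(** Once a resolution exists, the value chosen by [epsilon] comes from some resolution, and
    [tor_dim_kclass] holds for any of them. *)
Lemma betti_stable_neq0 i j : betti f M i (i%:Z + j) <> 0%N <->
  exists a u, in_GM f I j u a /\ i%:Z + j <= (mmax u)%:Z + f a.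
Proof.
have [P HP] := graded_free_resolution_exists graded_stable.
have [P' [HP' ->]] : exists P', graded_free_resolution f M P' /\
    betti f M i (i%:Z + j) = tor_dim P' i (i%:Z + j).
  apply: (epsilon_spec (inhabits 0%N) (fun b => exists P, graded_free_resolution f M P /\ b = tor_dim P i (i%:Z + j))).
  by exists (tor_dim P i (i%:Z + j)), P.
rewrite (tor_dim_kclass HP'); split; first exact: kclass_stable_sub.
by case=> a [u [h1 h2]]; apply: (kclass_stable_sup hM h1 h2).
Qed.

End Main.

Theorem theorem3p3 (K : fieldType) (n r : nat) (f : 'I_r -> int)
    (hf : forall i j : 'I_r, (i <= j)%N -> f i <= f j)
    (I : 'I_r -> {mpoly K[n]} -> Prop) (M : 'rV[{mpoly K[n]}]_r -> Prop)
    (hM : sqfree_stable f I M) (hproper : exists v, ~ M v)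
    (k : nat) (l : int) :
  extremal_betti f M k l <->
  is_max (fun x => exists (i : 'I_r) (u : 'X_{1..n}),
            in_GM f I l u i /\ x = (mmax u)%:Z + f i)
    (k%:Z + l) /\
  (forall (j : int) (u : 'X_{1..n}) (i : 'I_r), l < j ->
     in_GM f I j u i -> (mmax u)%:Z + f i < k%:Z + j).
Proof.
have zero i j : betti f M i (i%:Z + j) = 0%N <->
    forall a u, in_GM f I j u a -> (mmax u)%:Z + f a < i%:Z + j.
  split=> [h a u hu|h].
    rewrite ltNge; apply/negP => le.
    by case: (proj2 (betti_stable_neq0 hM i j)) => //; exists a, u.
  apply/eqP/contraT => /eqP /(betti_stable_neq0 hM)[a [u [/h h1 h2]]].
  by move: h1; rewrite ltNge h2.
split.
  case=> /(betti_stable_neq0 hM)[a [u [hu le]]] hz; split.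
    (* Vanishing at (k + 1, l) bounds all generators of degree [l] by k + l; nonvanishing at (k, l)
       makes this bound attained. *)
    have le' b v : in_GM f I l v b -> (mmax v)%:Z + f b <= k%:Z + l.
      have /zero h := hz k.+1 l (leqnSn k) (lexx l) (fun e => n_Sn k (esym (congr1 fst e))).
      by move/h; lia.
    split=> [|x [b [v [hv ->]]]]; last exact: le'.
    by exists a, u; split=> //; apply/eqP; rewrite eq_le le le'.
  move=> j v b lj hv.
  have /zero : betti f M k (k%:Z + j) = 0%N.
    by apply: hz => //; [exact: ltW | case=> e; rewrite e ltxx in lj].
  exact.
case=> [[[a [u [hu e]]] hmax] hj]; split.
  by apply/(betti_stable_neq0 hM); exists a, u; split=> //; rewrite e.
move=> i j ki lj ne; apply/zero => b v hv.
move: lj; rewrite le_eqVlt => /orP[/eqP el|lj].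
  (* For [j = l] the pairs differ, so i > k and the maximum k + l lies below i + l. *)
  subst j; have := hmax _ (ex_intro _ b (ex_intro _ v (conj hv erefl))).
  have : (k != i) by apply: contra_not_neq ne => ->.
  lia.
by have := hj j v b lj hv; lia.
Qed.
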